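(* Let $k$ be a field of prime characteristic $p$ and consider $$R=\frac{k[t,x,y]}{(f_1,\ldots,f_r)},$$ where $f_1,\ldots,f_r$ are polynomials that are homogeneous with respect to the grading in which $\deg t=0$ and $\deg x=\deg y=1$. Then the Frobenius powers of the ideal $I=(x,y)$ of $R$ have linear growth of primary decompositions.
   Context: For an ideal $J$ of a ring of prime characteristic $p$ and $q=p^e$ ($e\ge 0$ an integer), the Frobenius power $J^{[q]}$ is the ideal generated by the $q$th powers of generators of $J$. The notation $J^{c[q]}$ means $(J^c)^{[q]}$, the $q$th Frobenius power of the ordinary $c$th power of $J$. The Frobenius powers of an ideal $I$ have linear growth of primary decompositions if there exists a positive integer $c$ such that, for each $q=p^e$, there is a primary decomposition $I^{[q]}=Q_1\cap\cdots\cap Q_s$ ($s$ depending on $q$) with $(\sqrt{Q_i})^{c[q]}\subseteq Q_i$ for all $i=1,\ldots,s$. *)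

(* Defs.v *)
(* MathComp, with MathComp-Analysis' classical sets: an ideal is a [set R]. *)
From HB Require Import structures.
From mathcomp Require Import all_boot all_order all_algebra.
From mathcomp Require Import mpoly boolp classical_sets.

Set Implicit Arguments.
Unset Strict Implicit.
Unset Printing Implicit Defensive.

Import GRing.Theory.
Local Open Scope ring_scope.
Local Open Scope quotient_scope.
Local Open Scope classical_set_scope.

Section Ideals.
Variable R : comPzRingType.
Implicit Types (A I J : set R) (x y : R).

Definition is_ideal J : Prop :=
  [/\ J 0, forall x y, J x -> J y -> J (x + y) & forall a x, J x -> J (a * x)].

Definition ideal_gen A : set R := smallest is_ideal A.

Definition ideal_power J (c : nat) : set R :=
  ideal_gen [set \prod_(i < c) u i | u in [set u : 'I_c -> R | forall i, J (u i)]].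

(* Generated by the q-th powers of all elements of J; for q a power of the
   characteristic, [frobenius_power_gen] shows that the q-th powers of any set
   of generators of J suffice. *)
Definition frobenius_power J (q : nat) : set R :=
  ideal_gen [set x ^+ q | x in J].

Definition radical J : set R := [set x | exists n : nat, J (x ^+ n)].

Definition primary_ideal J : Prop :=
  [/\ is_ideal J, J <> setT & forall x y, J (x * y) -> J x \/ radical J y].

(* The empty family (s = 0) decomposes the unit ideal. *)
Definition primary_decomposition J (s : nat) (Q : 'I_s -> set R) : Prop :=
  (forall i, primary_ideal (Q i)) /\ J = \bigcap_i Q i.

Definition linear_growth_primary_decompositions (p : nat) I : Prop :=
  exists2 c : nat, (0 < c)%N &
    forall e : nat, exists (s : nat) (Q : 'I_s -> set R),
      primary_decomposition (frobenius_power I (p ^ e)) Q /\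
      forall i, frobenius_power (ideal_power (radical (Q i)) c) (p ^ e)
                  `<=` Q i.

Lemma is_ideal_gen A : is_ideal (ideal_gen A).
Proof.
split=> [J [[]]//|x y xA yA J JA|a x xA J JA].
  by have [[_ JD _] _] := JA; apply: JD; [apply: xA|apply: yA].
by have [[_ _ JM] _] := JA; apply: JM; apply: xA.
Qed.

Lemma exprDn_pchar p e (x y : R) : prime p -> p%:R = 0 :> R ->
  (x + y) ^+ (p ^ e) = x ^+ (p ^ e) + y ^+ (p ^ e).
Proof.
move=> p_pr pR; elim: e => [|e IH]; first by rewrite !expr1.
rewrite expnSr !exprM IH; move: (x ^+ _) (y ^+ _) => {IH x y} x y.
case: p p_pr pR => // p p_pr pR.
rewrite exprDn big_ord_recl big_ord_recr /= subn0 subnn !expr0 mulr1 mul1r.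
rewrite bin0 binn !mulr1n big1 ?add0r // => i _.
have /dvdnP[m ->] : (p.+1 %| 'C(p.+1, bump 0 i))%N.
  by apply: prime_dvd_bin => //; rewrite /bump /= add1n ltnS ltn_ord.
by rewrite -mulr_natr natrM pR !mulr0.
Qed.

Lemma frobenius_power_gen p e A : prime p -> p%:R = 0 :> R ->
  frobenius_power (ideal_gen A) (p ^ e) = ideal_gen [set x ^+ (p ^ e) | x in A].
Proof.
move=> p_pr pR; have qD := exprDn_pchar e _ _ p_pr pR.
have q0 : 0 ^+ (p ^ e) = 0 :> R by rewrite expr0n expn_eq0 -leqn0 leqNgt prime_gt0.
move: (p ^ e)%N qD q0 => q qD q0; set K := ideal_gen [set x ^+ q | x in A].
have [K0 KD KM] : is_ideal K by exact: is_ideal_gen.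
apply/seteqP; split; apply: smallest_sub; try exact: is_ideal_gen.
  move=> _ [x xA <-]; apply: (xA [set x | K (x ^+ q)]); split.
    split=> [|y z Ky Kz|a y Ky] /=; first by rewrite q0.
      by rewrite qD; apply: KD.
    by rewrite exprMn; apply: KM.
  by move=> y yA; apply: sub_gen_smallest; exists y.
move=> _ [x xA <-]; apply: sub_gen_smallest; exists x => //.
exact: sub_gen_smallest.
Qed.

End Ideals.

(* The quotient of R by the ideal generated by A. MathComp's [{ideal_quot _}]
   is a ring for proper ideals only; here the zero ring is allowed. *)
Section QuotientRing.
Variables (R : comPzRingType) (A : set R).

Definition ideal_gen_pred : pred R := fun x => `[< ideal_gen A x >].

Lemma ideal_gen_pred_zmod_closed : zmod_closed ideal_gen_pred.
Proof.
have [A0 AD AM] := is_ideal_gen A.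
split=> [|x y /asboolP xA /asboolP yA]; apply/asboolP => //.
by apply: AD => //; rewrite -mulN1r; apply: AM.
Qed.

HB.instance Definition _ :=
  GRing.isZmodClosed.Build R ideal_gen_pred ideal_gen_pred_zmod_closed.

Definition ideal_gen_zmod : zmodClosed R :=
  GRing.ZmodClosed.clone R ideal_gen_pred _.

Definition quotient_ring : Type := {ideal_quot ideal_gen_zmod}.

HB.instance Definition _ := GRing.Zmodule.on quotient_ring.

Definition quotient_map : R -> quotient_ring := \pi_({ideal_quot ideal_gen_zmod}).

Lemma quotient_map_eq x y :
  (quotient_map x = quotient_map y) <-> ideal_gen A (x - y).
Proof.
rewrite /quotient_map; split=> [/eqP|xy].
  by rewrite -Quotient.idealrBE => /asboolP.
by apply/eqP; rewrite -Quotient.idealrBE; apply/asboolP.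
Qed.

Lemma quotient_map_surj (z : quotient_ring) : exists x, quotient_map x = z.
Proof. by exists (repr z); rewrite /quotient_map reprK. Qed.

Let one := quotient_map 1.
Let mul (z w : quotient_ring) : quotient_ring :=
  quotient_map (repr z * repr w).

Let mapM x y : mul (quotient_map x) (quotient_map y) = quotient_map (x * y).
Proof.
have [_ AD AM] := is_ideal_gen A.
have rA u : ideal_gen A (repr (quotient_map u) - u).
  by apply/quotient_map_eq; rewrite /quotient_map reprK.
apply/quotient_map_eq; rewrite -(subrK (repr (quotient_map x) * y)
  (_ * repr (quotient_map y))) -mulrBr -addrA -mulrBl.
by apply: AD; [apply: AM|rewrite mulrC; apply: AM].
Qed.

Let mapD x y : quotient_map (x + y) = quotient_map x + quotient_map y.
Proof. exact: Quotient.pi_add. Qed.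

Let mulA : associative mul.
Proof.
move=> u v w; have [x <-] := quotient_map_surj u.
have [y <-] := quotient_map_surj v; have [z <-] := quotient_map_surj w.
by rewrite !mapM mulrA.
Qed.

Let mulC : commutative mul.
Proof. by move=> u v; rewrite /mul mulrC. Qed.

Let mul1 : left_id one mul.
Proof. by move=> u; have [x <-] := quotient_map_surj u; rewrite mapM mul1r. Qed.

Let mulDl : left_distributive mul +%R.
Proof.
move=> u v w; have [x <-] := quotient_map_surj u.
have [y <-] := quotient_map_surj v; have [z <-] := quotient_map_surj w.
by rewrite -mapD !mapM mulrDl mapD.
Qed.

HB.instance Definition _ :=
  GRing.Zmodule_isComPzRing.Build quotient_ring mulA mulC mul1 mulDl.

Lemma quotient_map_is_zmod_morphism : zmod_morphism quotient_map.
Proof. by move=> x y; apply: (raddfB \pi_({ideal_quot ideal_gen_zmod})). Qed.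

HB.instance Definition _ := GRing.isZmodMorphism.Build R quotient_ring
  quotient_map quotient_map_is_zmod_morphism.

Lemma quotient_map_is_monoid_morphism : monoid_morphism quotient_map.
Proof. by split=> // x y; rewrite -mapM. Qed.

HB.instance Definition _ := GRing.isMonoidMorphism.Build R quotient_ring
  quotient_map quotient_map_is_monoid_morphism.

End QuotientRing.

(* The variables t, x, y of k[t, x, y] are those of index 0, 1, 2. *)
Definition i_x : 'I_3 := @Ordinal 3 1 isT.
Definition i_y : 'I_3 := @Ordinal 3 2 isT.

Definition xy_degree (m : 'X_{1..3}) : nat := (m i_x + m i_y)%N.

Lemma xy_degree0 : xy_degree 0%MM = 0%N.
Proof. by rewrite /xy_degree !mnm0E. Qed.

Lemma xy_degreeD : {morph xy_degree : m1 m2 / (m1 + m2)%MM >-> (m1 + m2)%N}.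
Proof. by move=> m1 m2; rewrite /xy_degree !mnmDE addnACA. Qed.

HB.instance Definition _ := isMeasure.Build 3 xy_degree xy_degree0 xy_degreeD.

(* Main.v *)
From HB Require Import structures.
Require Import Defs.
From mathcomp Require Import all_boot all_order perm all_algebra.
From mathcomp Require Import ring mpoly boolp classical_sets.

Set Implicit Arguments.
Unset Strict Implicit.
Unset Printing Implicit Defensive.

Import GRing.Theory.
Local Open Scope ring_scope.
Local Open Scope classical_set_scope.

(** Put [A = k[t]], [S = k[t,x,y]] and [J = (f_1, ..., f_r, x^q, y^q)] in [S].
    Every prime containing [J] contains [x] and [y], so it is [(x,y)] or
    [(x,y,P)] with [P] in [A] irreducible, and the primary decomposition of
    [J] is governed by the [A]-torsion of [S/J]: the [(x,y)]-component is the
    preimage of the torsion, and the [(x,y,P)]-component is, for [N] large,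
    the contraction of [J + (P^N)] from the localization at [(P)].  Such a
    component contains the [q]-th Frobenius power of [(x,y,P)^c] as soon as
    [cq >= N]; so all that matters is to take [N] linear in [q], uniformly in
    [P].  This is possible as soon as [P^N] kills the [P]-power torsion of
    [S/J] ([primary_decomposition_growth]).

    The bound on the torsion comes from the grading.  The degree [n] part of
    [S/J] is a quotient of the free module [A^(n+1)], on the monomials
    [x^i y^(n-i)], by relations that are generated by vectors whose entries
    have [t]-degree at most [D], where [D] bounds the [t]-degrees of the [f_i]
    and does not depend on [q] ([mem_relations]).  By Cramer's rule, a nonzero
    minor of maximal size kills the torsion of such a quotient, and that minor
    has degree at most [(n+1)D] ([bounded_torsion]).  Since the graded part
    vanishes for [n >= 2q] ([relations_full]), the torsion in each degree is
    killed by a polynomial of degree at most [2qD]; no irreducible [P] occurs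
    in it with an exponent above [2qD], so [c = 2D + 1] works for all [q]. *)

(** * Factorization in k[t] *)

Section Factorization.
Variable k : fieldType.
Implicit Types (g h P G : {poly k}).

(** The generators of the prime ideals of [k[t]].  The zero ideal is kept along
    with the maximal ones because it gives the [(x,y)]-primary component. *)
Definition generates_prime h : Prop :=
  ~~ (h %| 1) /\ forall a b, h %| a * b -> (h %| a) || (h %| b).

Lemma generates_prime0 : generates_prime (0 : {poly k}).
Proof. by split=> [|a b]; rewrite !dvd0p ?oner_neq0 // mulf_eq0. Qed.

Lemma irreducible_prime P : irreducible_poly P -> generates_prime P.
Proof.
move=> irrP; split=> [|a b].
  by rewrite -irreducible_poly_coprime // coprimep1.
have [//|/= ndv] := boolP (P %| a); rewrite Gauss_dvdpr //.
by rewrite irreducible_poly_coprime.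
Qed.

Lemma irreducible_factor G : (1 < size G)%N ->
  exists2 P, irreducible_poly P & P %| G.
Proof.
have [n] := ubnP (size G); elim: n G => // n IH G szn G1.
have [irr|nirr] := pselect (irreducible_poly G); first by exists G.
have [q [q1 qG nq]] : exists q : {poly k}, [/\ size q != 1, q %| G & ~~ (q %= G)].
  apply: contrapT => no; apply: nirr; split=> // q q1 qG.
  by apply/negP => /negP nq; apply: no; exists q.
have G0 : G != 0 by rewrite -size_poly_gt0 ltnW.
have szq : (size q < size G)%N.
  by rewrite ltn_neqAle dvdp_leq // andbT dvdp_size_eqp.
have q0 : q != 0 by apply: contraNneq G0 => q0; rewrite -dvd0p -q0.
have [||P irrP Pq] := IH q; first exact: leq_trans szq _.
  by rewrite ltn_neqAle eq_sym q1 size_poly_gt0.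
by exists P => //; apply: dvdp_trans Pq qG.
Qed.

Lemma irreducible_factorization G : G != 0 -> exists s : seq {poly k},
  (forall P, P \in s -> irreducible_poly P) /\ G %| \prod_(P <- s) P.
Proof.
have [n] := ubnP (size G); elim: n G => // n IH G szn G0.
have [G1|G1] := leqP (size G) 1.
  exists [::]; split=> //; rewrite big_nil dvdp1 eqn_leq G1.
  by rewrite size_poly_gt0.
have [P irrP /dvdpP[H GE]] := irreducible_factor G1.
have P0 := irredp_neq0 irrP; have H0 : H != 0.
  by apply: contraNneq G0 => H0; rewrite GE H0 mul0r.
have [||s [irrs Hs]] := IH H => //.
  rewrite -ltnS (leq_trans _ szn) // ltnS GE size_mul //.
  by case: irrP => + _; case: (size P) => [|[|m]] // _; rewrite !addnS /= leq_addr.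
exists (P :: s); split; last by rewrite big_cons GE mulrC dvdp_mul.
by move=> Q; rewrite inE => /predU1P[->|/irrs].
Qed.

(** The bound on [m], crude when [P] has degree above 1, is what turns the
    degree of a polynomial that kills torsion into an exponent of [P]. *)
Lemma irreducible_multiplicity P G : irreducible_poly P -> G != 0 ->
  exists m g, [/\ G = P ^+ m * g, ~~ (P %| g) & (m < size G)%N].
Proof.
move=> irrP; have [n] := ubnP (size G); elim: n G => // n IH G szn G0.
have [/dvdpP[H GE]|ndv] := boolP (P %| G); last first.
  by exists 0, G; rewrite mul1r size_poly_gt0.
have P0 := irredp_neq0 irrP; have H0 : H != 0.
  by apply: contraNneq G0 => H0; rewrite GE H0 mul0r.
have szH : (size H < size G)%N.
  rewrite GE size_mul //; case: irrP => + _.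
  by case: (size P) => [|[|m]] // _; rewrite !addnS ltnS leq_addr.
have [||m [g [HE ndv mH]]] := IH H => //; first exact: leq_trans szH _.
exists m.+1, g; split=> //; last exact: leq_ltn_trans mH szH.
by rewrite GE HE mulrC exprS mulrA.
Qed.

Lemma coprimep_bezout P g : coprimep P g -> exists u v, u * P + v * g = 1.
Proof.
move=> /Bezout_coprimepP[[u v]] /=; rewrite -size_poly_eq1 => /size_poly1P[c c0].
move=> E; exists (c^-1 *: u), (c^-1 *: v).
by rewrite -!scalerAl -scalerDr E -mul_polyC -polyCM mulVf.
Qed.

End Factorization.

(** * Torsion of modules with relations of bounded degree *)

Section Span.
Variables (A : pzRingType) (V : lmodType A).
Implicit Types (W : set V) (v w : V).

Definition is_submodule W : Prop :=
  [/\ W 0, forall v w, W v -> W w -> W (v + w) & forall a v, W v -> W (a *: v)].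

Definition submodule_gen W : set V := smallest is_submodule W.

Lemma is_submodule_gen W : is_submodule (submodule_gen W).
Proof.
split=> [N [[]]//|v w Wv Ww N WN|a v Wv N WN].
  by have [[_ ND _] _] := WN; apply: ND; [apply: Wv|apply: Ww].
by have [[_ _ NM] _] := WN; apply: NM; apply: Wv.
Qed.

Lemma submodule_sum N (I : Type) (r : seq I) (F : I -> V) :
  is_submodule N -> (forall i, N (F i)) -> N (\sum_(i <- r) F i).
Proof. by case=> N0 ND _ NF; apply: big_ind. Qed.

End Span.

Lemma submodule_gen_map (A : pzRingType) (V V' : lmodType A)
    (f : {linear V -> V'}) (W : set V) (W' : set V') :
  (forall w, W w -> submodule_gen W' (f w)) ->
  forall v, submodule_gen W v -> submodule_gen W' (f v).
Proof.
move=> WW' v Wv; apply: (Wv [set v | submodule_gen W' (f v)]); split=> //.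
have [W0 WD WM] := is_submodule_gen W'.
split=> [|u w /= Wu Ww|a u /= Wu]; rewrite /= ?linear0 ?linearD ?linearZ //.
  exact: WD.
exact: WM.
Qed.

Section BoundedTorsion.
Variables (k : fieldType) (l D : nat) (W : set 'rV[{poly k}]_l).
Hypothesis W_size : forall (w : 'rV[{poly k}]_l) j,
  W w -> (size (w 0%R j) <= D.+1)%N.

Local Notation A := {poly k}.
Local Notation K := {fraction A}.
Local Notation "M ^K" := (map_mx (@tofrac A) M) (at level 2, format "M ^K").

Lemma size_det_leq r (B : 'M[A]_r) :
  (forall i j, (size (B i j) <= D.+1)%N) -> (size (\det B) <= (r * D).+1)%N.
Proof.
move=> szB; rewrite /determinant (leq_trans (size_sum _ _ _)) //.
apply/bigmax_leqP => s _; rewrite -signr_odd.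
have: (size (\prod_i B i (s i))%R <= (r * D).+1)%N.
  rewrite (leq_trans (size_poly_prod_leq _ _)) //= card_ord leq_subLR.
  rewrite addnS ltnS (leq_trans (leq_sum _ (fun i _ => szB i (s i)))) //.
  by rewrite sum_nat_const card_ord mulnS.
by case: (odd _); rewrite ?mulN1r ?size_polyN // mul1r.
Qed.

(** [W] may be infinite; a maximal family of independent rows replaces a
    finite generating set of its span. *)
Lemma maximal_independent_rows : exists r (M : 'M[A]_(r, l)),
  [/\ forall i, W (row i M), row_free M^K &
      forall w, W w -> (w^K <= M^K)%MS].
Proof.
pose has_rows r := `[< exists M : 'M[A]_(r, l),
  (forall i, W (row i M)) /\ row_free M^K >].
have has0 : has_rows 0%N.
  by apply/asboolP; exists 0; split=> [[]//|]; rewrite /row_free -leqn0 rank_leq_row.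
have bound r : has_rows r -> (r <= l)%N.
  by move=> /asboolP[M [_ /eqP <-]]; exact: rank_leq_col.
have [r /asboolP[M [MW Mfree]] rmax] := ex_maxnP (ex_intro _ 0%N has0) bound.
exists r, M; split=> // w Ww; apply: contrapT => /negP nw.
suff: (r.+1 <= r)%N by rewrite ltnn.
rewrite -addn1; apply: rmax; apply/asboolP; exists (col_mx M w); split.
  move=> i; rewrite -(splitK i); case: (split i) => j /=.
    by rewrite rowKu.
  by rewrite rowKd (ord1 j) row_id.
rewrite map_col_mx /row_free eqn_leq rank_leq_row /=.
apply: (@leq_trans (\rank M^K).+1); first by rewrite (eqP Mfree) addn1.
apply: rank_ltmx.
rewrite /ltmx col_mx_sub negb_and nw orbT andbT.
by rewrite -addsmxE addsmxSl.
Qed.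

(** Cramer's rule.  Over the fraction field, [v] is a combination of the rows
    of [M], a maximal independent family taken from [W]; its coefficients are
    determined by [r] columns of [v] for which the minor [B] of [M] is
    invertible, so that [\det B] is a common denominator for them.  It is a
    determinant of size [r <= l] with entries of degree at most [D]. *)
Lemma bounded_torsion : exists Delta : A,
  [/\ Delta != 0, (size Delta <= (l * D).+1)%N &
   forall g v, g != 0 -> submodule_gen W (g *: v) ->
     submodule_gen W (Delta *: v)].
Proof.
have [r [M [MW Mfree WM]]] := maximal_independent_rows.
have Mfull : row_full (M^K)^T by rewrite /row_full mxrank_tr.
pose f := fullrankfun Mfull; pose B := colsub f M.
have Bunit : B^K \in unitmx.
  have -> : B^K = (rowsub f (M^K)^T)^T by apply/matrixP => i j; rewrite !mxE.
  by rewrite unitmx_tr fullrowsub_unit.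
exists (\det B); split.
- by move: Bunit; rewrite unitmxE det_map_mx unitfE tofrac_eq0.
- have rl : (r <= l)%N by rewrite -(eqP Mfree) rank_leq_col.
  apply: (@leq_trans (r * D).+1); last by rewrite ltnS leq_mul2r rl orbT.
  apply: size_det_leq => i j; rewrite mxE.
  by have := W_size (f j) (MW i); rewrite mxE.
move=> g v g0 gvW.
have vM : (v^K <= M^K)%MS.
  have: ((g *: v)^K <= M^K)%MS.
    apply: (gvW [set v | (v^K <= M^K)%MS]); split=> //; split=> [|u w|a u] /=.
    - by rewrite raddf0 sub0mx.
    - by rewrite raddfD; exact: addmx_sub.
    - by rewrite map_mxZ; exact: scalemx_sub.
  have gK : tofrac g != 0 by rewrite tofrac_eq0.
  by rewrite map_mxZ (eqmx_scale (v^K) gK).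
have [u vE] := submxP vM.
have -> : \det B *: v = colsub f v *m \adj B *m M.
  suff: (\det B *: v)^K = (colsub f v *m \adj B *m M)^K.
    move=> /matrixP E; apply/matrixP => i j; apply/eqP; rewrite -tofrac_eq.
    by apply/eqP; have := E i j; rewrite !mxE.
  have fE : (colsub f v)^K = u *m B^K.
    by rewrite map_mxsub vE -mulmx_colsub map_mxsub.
  rewrite !map_mxM fE map_mxZ -det_map_mx map_mx_adj -[u *m _ *m _]mulmxA.
  by rewrite mul_mx_adj mul_mx_scalar -scalemxAl -vE.
rewrite mulmx_sum_row; have subW := is_submodule_gen W.
apply: (submodule_sum _ subW) => i; case: subW => _ _; apply.
exact: sub_gen_smallest.
Qed.

End BoundedTorsion.

(** * Ideals and primary decompositions *)

Section IdealFacts.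
Variable R : comPzRingType.
Implicit Types (J Q : set R) (x y : R).

Lemma ideal_sub J x y : is_ideal J -> J x -> J y -> J (x - y).
Proof. by case=> _ JD JM Jx Jy; apply: JD => //; rewrite -mulN1r; apply: JM. Qed.

Lemma ideal_sum J (I : Type) (r : seq I) (F : I -> R) :
  is_ideal J -> (forall i, J (F i)) -> J (\sum_(i <- r) F i).
Proof. by case=> J0 JD _ JF; apply: big_ind. Qed.

Lemma ideal_mulr J x a : is_ideal J -> J x -> J (x * a).
Proof. by case=> _ _ JM Jx; rewrite mulrC; apply: JM. Qed.

Lemma is_ideal_radical J : is_ideal J -> is_ideal (radical J).
Proof.
move=> Ji; have [J0 JD JM] := Ji; split.
- by exists 1%N; rewrite expr1.
- move=> x y [m xm] [n yn]; exists (m + n)%N; rewrite exprDn.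
  apply: ideal_sum => // i; rewrite -mulr_natl; apply: (JM).
  have [ni|/ltnW ni] := leqP n i.
    by apply: (JM); rewrite -(subnKC ni) exprD; apply: ideal_mulr.
  by rewrite -addnBA // exprD -mulrA; apply: ideal_mulr.
- by move=> a x [m xm]; exists m; rewrite exprMn; apply: (JM).
Qed.

Lemma ideal_full J : is_ideal J -> J 1 -> J = setT.
Proof.
by move=> [_ _ JM] J1; apply/seteqP; split=> // x _; rewrite -[x]mulr1; apply: JM.
Qed.

(** A candidate component that turns out to be the unit ideal is not primary,
    but can be discarded without changing the intersection. *)
Lemma primary_decomposition_seq (T : choiceType) (P : set R -> Prop)
    (C : T -> set R) (s : seq T) J :
  (forall h, h \in s -> C h <> setT -> primary_ideal (C h) /\ P (C h)) ->
  (forall h, h \in s -> J `<=` C h) ->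
  (forall z, (forall h, h \in s -> C h z) -> J z) ->
  exists n (Q : 'I_n -> set R), primary_decomposition J Q /\ forall i, P (Q i).
Proof.
move=> Cprim JC CJ; pose s' := [seq h <- s | ~~ `[< C h = setT >]].
have s'P h : h \in s' -> h \in s /\ C h <> setT.
  by rewrite mem_filter => /andP[/asboolPn].
exists (size s'), (fun i => C (tnth (in_tuple s') i)); split; last first.
  by move=> i; have [] := s'P _ (mem_tnth i (in_tuple s')) => /Cprim H /H[].
split=> [i|].
  by have [] := s'P _ (mem_tnth i (in_tuple s')) => /Cprim H /H[].
apply/seteqP; split=> [z Jz i _|z Cz].
  by have [hs _] := s'P _ (mem_tnth i (in_tuple s')); apply: JC.
apply: CJ => h hs; have [->//|nT] := pselect (C h = setT).
have /tnthP[i ->] : h \in in_tuple s'.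
  by rewrite mem_filter hs andbT; apply/asboolPn.
exact: Cz.
Qed.

End IdealFacts.

(** * Components over the primes of k[t] *)

Section Components.
Variables (k : fieldType) (R : comPzRingType) (iota : {rmorphism {poly k} -> R}).
(* The ring is generated by [iota], [x] and [y], and [x], [y] are nilpotent
   modulo [J]: the primes containing [J] are then given by the primes of
   [k[t]]. *)
Variables (x y : R) (J : set R) (q c : nat).
Hypothesis gen_R : forall z, exists g a b, z = iota g + (x * a + y * b).
Hypothesis J_ideal : is_ideal J.
Hypotheses (Jx : J (x ^+ q)) (Jy : J (y ^+ q)).
Hypotheses (c_gt0 : (0 < c)%N) (q_gt0 : (0 < q)%N).
Implicit Types (g h P G : {poly k}) (z w : R).

(** The contraction of [J + (h^(cq))] from the localization at the prime [(h)]
    of [k[t]].  For [h = 0] this is the set of the torsion elements modulo [J];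
    for [h] irreducible it is [(x,y,h)]-primary or the unit ideal. *)
Definition component h : set R :=
  [set z | exists g a, ~~ (h %| g) /\ J (iota g * z + iota (h ^+ (c * q)) * a)].

Section AtPrime.
Variable h : {poly k}.
Hypothesis h_prime : generates_prime h.

Lemma ndvd_mul g g' : ~~ (h %| g) -> ~~ (h %| g') -> ~~ (h %| g * g').
Proof.
by move=> ng ng'; apply/negP => /h_prime.2; rewrite (negbTE ng) (negbTE ng').
Qed.

Lemma sub_component : J `<=` component h.
Proof.
move=> z Jz; exists 1, 0; split; first exact: h_prime.1.
by rewrite rmorph1 mul1r mulr0 addr0.
Qed.

Lemma component_pow : component h (iota (h ^+ (c * q))).
Proof.
exists 1, (-1); split; first exact: h_prime.1.
by rewrite rmorph1 mul1r mulrN1 subrr; case: J_ideal.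
Qed.

Lemma component_ideal : is_ideal (component h).
Proof.
have [J0 JD JM] := J_ideal; split; first exact: sub_component.
- move=> z w [g [a [ng gz]]] [g' [a' [ng' gw]]].
  exists (g * g'), (iota g' * a + iota g * a'); split; first exact: ndvd_mul.
  have := JD _ _ (JM (iota g') _ gz) (JM (iota g) _ gw).
  move: (h ^+ _) => P; congr J; ring.
- move=> b z [g [a [ng gz]]]; exists g, (b * a); split=> //.
  by rewrite !(mulrCA _ b) -mulrDr; apply: JM.
Qed.

(** The purpose of the localization: the elements of [k[t]] outside [(h)] act
    injectively modulo the component. *)
Lemma component_regular g z :
  ~~ (h %| g) -> component h (iota g * z) -> component h z.
Proof.
move=> ng [g' [a [ng' gz]]]; exists (g' * g), a.
by split; [exact: ndvd_mul|rewrite rmorphM -mulrA].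
Qed.

Let rad_ideal := is_ideal_radical component_ideal.

Lemma radical_component_xy a b : radical (component h) (x * a + y * b).
Proof.
have [_ rD _] := rad_ideal; apply: rD; apply: ideal_mulr => //;
  exists q; exact: sub_component.
Qed.

Lemma radical_component_iota g : h %| g -> radical (component h) (iota g).
Proof.
move=> /dvdpP[g' ->]; rewrite rmorphM; have [_ _ rM] := rad_ideal; apply: rM.
by exists (c * q)%N; rewrite -rmorphXn; exact: component_pow.
Qed.

Lemma radical_component z : component h <> setT -> radical (component h) z ->
  exists a b d, z = iota h * a + (x * b + y * d).
Proof.
move=> proper zr; have [g [a [b zE]]] := gen_R z.
have [/dvdpP[g' gE]|ng] := boolP (h %| g).
  by exists (iota g'), a, b; rewrite zE gE rmorphM [iota h * _]mulrC.
case: proper; apply: ideal_full; first exact: component_ideal.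
have [n] : radical (component h) (iota g).
  have -> : iota g = z - (x * a + y * b) by rewrite zE addrK.
  by apply: ideal_sub => //; exact: radical_component_xy.
elim: n => [|n IH]; first by rewrite expr0.
by rewrite exprS => /(component_regular ng).
Qed.

(** An element [w] is [iota g] plus a nilpotent [v] modulo the component.  If
    [h] divides [g] then [w] is nilpotent too.  Otherwise [iota g] is regular,
    and [z w = 0] gives [iota g z = - z v]: each vanishing [z v^(n+1) = 0]
    descends to [z v^n = 0], so [z = 0]. *)
Lemma component_primary : component h <> setT -> primary_ideal (component h).
Proof.
move=> proper; split=> //; first exact: component_ideal.
move=> z w zw; have [g [a [b wE]]] := gen_R w.
have [hg|ng] := boolP (h %| g).
  right; rewrite wE; have [_ rD _] := rad_ideal; apply: rD.
    exact: radical_component_iota.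
  exact: radical_component_xy.
left; have [n nil] := radical_component_xy a b.
move: (x * a + y * b) wE nil => v wE.
have [_ _ CM] := component_ideal.
move=> nil; have {nil} : component h (z * v ^+ n) by exact: CM.
elim: n => [|n IH zv]; first by rewrite expr0 mulr1.
apply: IH; apply: (component_regular ng).
have -> : iota g * (z * v ^+ n) = v ^+ n * (z * w) - z * v ^+ n.+1.
  by rewrite wE exprSr; ring.
by apply: ideal_sub => //; [exact: component_ideal|exact: CM].
Qed.

(** The radical is contained in [(iota h, x, y)], so the [q]-th power of one of
    its elements is, modulo [x^q] and [y^q], a multiple of [iota h ^+ q]; a
    product of [c] of them is then a multiple of [iota (h ^+ (c * q))]. *)
Lemma component_growth p e : prime p -> p%:R = 0 :> R -> q = (p ^ e)%N ->
  component h <> setT ->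
  frobenius_power (ideal_power (radical (component h)) c) q `<=` component h.
Proof.
move=> p_pr pR qE proper.
have qD u v : (u + v) ^+ q = u ^+ q + v ^+ q :> R.
  by rewrite qE Defs.exprDn_pchar.
have Ci := component_ideal; have [C0 CD CM] := Ci.
apply: smallest_sub => // _ [w wpow <-].
apply: (wpow [set w | component h (w ^+ q)]); split.
  split=> [|u v /= uC vC|a u /= uC] /=; first by rewrite expr0n gtn_eqF.
    by rewrite qD; apply: CD.
  by rewrite exprMn; apply: CM.
move=> _ [u urad <-] /=; rewrite -prodrXl.
have step (r : seq 'I_c) : exists d,
    component h (\prod_(i <- r) u i ^+ q - iota h ^+ (q * size r) * d).
  elim: r => [|i r [d IH]].
    by exists 1; rewrite big_nil muln0 expr0 mulr1 subrr.
  have [a [b [b' uE]]] := radical_component proper (urad i).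
  have {uE} uq : component h (u i ^+ q - iota h ^+ q * a ^+ q).
    rewrite uE !qD !exprMn addrC addrA addNr add0r; apply: CD.
      by apply: ideal_mulr => //; exact: sub_component.
    by apply: ideal_mulr => //; exact: sub_component.
  exists (a ^+ q * d); rewrite big_cons /= mulnS exprD.
  move: (\prod_(j <- r) _) IH => B IH; set E := iota h ^+ (q * _) in IH *.
  have -> : u i ^+ q * B - iota h ^+ q * E * (a ^+ q * d) =
      B * (u i ^+ q - iota h ^+ q * a ^+ q)
      + (iota h ^+ q * a ^+ q) * (B - E * d).
    by move: (iota h ^+ q) (a ^+ q) (u i ^+ q) => *; ring.
  by apply: CD; apply: CM.
have [d] := step (index_enum 'I_c).
have -> : size (index_enum 'I_c) = c.
  by rewrite [index_enum _]unlock -enumT size_enum_ord.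
rewrite mulnC -rmorphXn => uC.
rewrite -[\prod_(i < c) _](subrK (iota (h ^+ (c * q)) * d)).
by apply: CD => //; apply: ideal_mulr => //; exact: component_pow.
Qed.

End AtPrime.

(** The annihilator of [z] modulo [J] contains a product of irreducible
    polynomials and lies in none of the ideals that they generate: it is the
    unit ideal. *)
Lemma annihilator_coprime (s : seq {poly k}) z :
  (forall P, P \in s -> irreducible_poly P) ->
  (forall P, P \in s -> exists2 g, ~~ (P %| g) & J (iota g * z)) ->
  J (iota (\prod_(P <- s) P) * z) -> J z.
Proof.
have [J0 JD JM] := J_ideal.
elim: s => [|P s IH] irr co; first by rewrite big_nil rmorph1 mul1r.
rewrite big_cons => Jz; apply: IH => [Q Qs|Q Qs|].
- by apply: irr; rewrite inE Qs orbT.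
- by apply: co; rewrite inE Qs orbT.
have [g' ng' g'z] := co P (mem_head _ _).
have : coprimep P g'.
  by rewrite irreducible_poly_coprime //; apply: irr; exact: mem_head.
move=> /coprimep_bezout[u [v uv]].
move: (\prod_(Q <- s) Q) Jz => H Jz.
have -> : iota H * z =
    iota u * (iota (P * H) * z) + iota (v * H) * (iota g' * z).
  by rewrite -[H in LHS]mul1r -uv; ring.
by apply: JD; apply: JM.
Qed.

Variable G : {poly k}.
Hypothesis G_neq0 : G != 0.
Hypothesis G_torsion : forall g z, g != 0 -> J (iota g * z) -> J (iota G * z).
Hypothesis P_torsion : forall P m z, irreducible_poly P ->
  J (iota (P ^+ m) * z) -> J (iota (P ^+ (c * q)) * z).

(** Locally at [(P)], torsion meets [J + (P^N)] only in [J]: if [z] is torsion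
    and [g z = - P^N a] modulo [J], then [a] is torsion as well, so locally it
    is killed by a power of [P], hence by [P^N]. *)
Lemma component_irreducible P z : irreducible_poly P -> J (iota G * z) ->
  component P z -> exists2 g, ~~ (P %| g) & J (iota g * z).
Proof.
move=> irrP Gz [g [a [ng gz]]].
have [J0 JD JM] := J_ideal.
have [m [g' [GE ng' _]]] := irreducible_multiplicity irrP G_neq0.
have Ga : J (iota G * a).
  have PN0 : P ^+ (c * q) * G != 0.
    by rewrite mulf_neq0 // expf_neq0 // irredp_neq0.
  apply: (G_torsion PN0).
  rewrite rmorphM mulrAC mulrC.
  have -> : iota G * (iota (P ^+ (c * q)) * a) =
     iota G * (iota g * z + iota (P ^+ (c * q)) * a) - iota g * (iota G * z).
    by move: (P ^+ _) => *; ring.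
  by apply: ideal_sub => //; apply: JM.
have g'a : J (iota (P ^+ (c * q)) * (iota g' * a)).
  by apply: (P_torsion (m := m) irrP); rewrite mulrA -rmorphM -GE.
exists (g' * g); first exact: (ndvd_mul (irreducible_prime irrP)).
have -> : iota (g' * g) * z = iota g' * (iota g * z + iota (P ^+ (c * q)) * a)
    - iota (P ^+ (c * q)) * (iota g' * a).
  by move: (P ^+ _) => *; ring.
by apply: ideal_sub => //; apply: JM.
Qed.

(** The components at [0] and at the irreducible factors of [G] suffice: an
    element of the first is killed by [G], and by [component_irreducible] its
    annihilator escapes every irreducible factor of [G]. *)
Lemma component_decomposition : exists s : seq {poly k},
  (forall h, h \in s -> generates_prime h) /\
  forall z, (forall h, h \in s -> component h z) -> J z.
Proof.
have [J0 JD JM] := J_ideal.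
have [s [irrs Gs]] := irreducible_factorization G_neq0.
exists (0 :: s); split=> [h|z Cz].
  by rewrite inE => /predU1P[->|/irrs /irreducible_prime //]; exact: generates_prime0.
have Gz : J (iota G * z).
  have [g [a [g0]]] := Cz 0 (mem_head _ _).
  rewrite expr0n muln_eq0 !gtn_eqF // rmorph0 mul0r addr0 => gz.
  by apply: (G_torsion _ gz); rewrite dvd0p in g0.
apply: (annihilator_coprime irrs) => [P Ps|].
  apply: component_irreducible => //; first exact: irrs.
  by apply: Cz; rewrite inE Ps orbT.
by have /dvdpP[b ->] := Gs; rewrite rmorphM -mulrA; apply: JM.
Qed.

Lemma primary_decomposition_growth p e :
  prime p -> p%:R = 0 :> R -> q = (p ^ e)%N ->
  exists s (Q : 'I_s -> set R), primary_decomposition J Q /\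
    forall i, frobenius_power (ideal_power (radical (Q i)) c) q `<=` Q i.
Proof.
move=> p_pr pR qE; have [s [ps sJ]] := component_decomposition.
apply: (primary_decomposition_seq (C := component) (s := s)
  (P := fun Q => frobenius_power (ideal_power (radical Q) c) q `<=` Q)) => //.
- move=> h /ps hp proper; split; first exact: component_primary.
  exact: component_growth qE proper.
- by move=> h /ps hp; exact: sub_component.
Qed.

End Components.

(** * The grading of k[t,x,y] by the degree in x and y *)

Section Grading.
Variable k : fieldType.
Local Notation A := {poly k}.
Local Notation S := {mpoly k[3]}.
Implicit Types (g G : A) (P : {poly A}) (z w : S).

Definition i_t : 'I_3 := @Ordinal 3 0 isT.

Definition graded_var (i : 'I_3) : {poly {poly A}} :=
  if i == i_t then 'X%:P%:P else if i == i_x then 'X%:P * 'X else 'X.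

(** The morphism [t |-> t], [x |-> u T], [y |-> T] into [k[t][u][T]]: the
    coefficient of [T^n] is the homogeneous part of degree [n], written in the
    basis [x^i y^(n-i)] as a polynomial in [u] of degree at most [n]. *)
Definition grading : S -> {poly {poly A}} :=
  mmap (polyC \o polyC \o polyC) graded_var.
HB.instance Definition _ := GRing.RMorphism.on grading.

Definition poly_in_t : A -> S := horner_alg ('X_i_t : S).
HB.instance Definition _ := GRing.LRMorphism.on poly_in_t.

Let grading0 : grading 0 = 0. Proof. exact: rmorph0. Qed.

Let gradingD z w : grading (z + w) = grading z + grading w.
Proof. exact: rmorphD. Qed.

Let gradingM z w : grading (z * w) = grading z * grading w.
Proof. exact: rmorphM. Qed.

Let gradingDn z w n :
  (grading (z + w))`_n = (grading z)`_n + (grading w)`_n.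
Proof. by rewrite gradingD coefD. Qed.

Lemma grading_term c m : grading (c *: 'X_[m]) =
  ((c *: 'X^(m i_t)) *: 'X^(m i_x))%:P * 'X^(xy_degree m).
Proof.
rewrite /grading mmapZ mmapX /mmap1 !big_ord_recl big_ord0 mulr1 /=.
have -> : ord0 = i_t by apply: val_inj.
have -> : lift i_t ord0 = i_x by apply: val_inj.
have -> : lift i_t (lift ord0 ord0) = i_y by apply: val_inj.
rewrite /graded_var /= -!rmorphXn exprMn -!mulrA -exprD -!rmorphXn.
rewrite !mulrA -!rmorphM.
by rewrite /= !mul_polyC.
Qed.

Lemma grading_xy z b c :
  grading ('X_i_x ^+ b * 'X_i_y ^+ c * z) = ('X^b)%:P * 'X^(b + c) * grading z.
Proof.
rewrite !rmorphM !rmorphXn /= /grading !mmapX !mmap1U /graded_var /=.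
by rewrite exprMn exprD mulrA.
Qed.

Lemma grading_poly_in_t g : grading (poly_in_t g) = g%:P%:P.
Proof.
elim/poly_ind: g => [|g c IH]; first by rewrite !rmorph0.
have iX : poly_in_t 'X = 'X_i_t by exact: horner_algX.
have iC : poly_in_t c%:P = c *: 'X_[0] by rewrite mpolyX0; exact: horner_algC.
have tX : grading 'X_i_t = 'X%:P%:P by rewrite /grading mmapX mmap1U.
rewrite rmorphD rmorphM /= iX iC gradingD gradingM IH tX grading_term.
by rewrite !mnm0E xy_degree0 !expr0 mulr1 -!mul_polyC !mulr1 -!rmorphM -!rmorphD.
Qed.

Lemma coef_grading_poly_in_t g z n :
  (grading (poly_in_t g * z))`_n = g *: (grading z)`_n.
Proof. by rewrite rmorphM /= grading_poly_in_t coefCM mul_polyC. Qed.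

Lemma grading_coef z m : (grading z)`_(xy_degree m)`_(m i_x)`_(m i_t) = z@_m.
Proof.
elim/mpolyind: z => [|c m' z _ _ IH]; first by rewrite grading0 !coef0 mcoeff0.
rewrite gradingDn !coefD IH mcoeffD mcoeffZ mcoeffX grading_term; congr (_ + _).
rewrite coefCM coefXn; have [<-|ne] := eqVneq m' m.
  by rewrite eqxx mulr1 coefZ coefXn eqxx !mulr1 coefZ coefXn eqxx mulr1.
have [dE|] := eqVneq (xy_degree m) _; last by rewrite !mulr0 !coef0.
rewrite mulr1 coefZ coefXn; have [xE|] := eqVneq (m i_x) _; last first.
  by rewrite !mulr0 coef0.
rewrite mulr1 coefZ coefXn; have [tE|] := eqVneq (m i_t) _; last by [].
case/eqP: ne; apply/mnmP => i.
have yE : m' i_y = m i_y.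
  by apply/eqP; rewrite -(eqn_add2l (m i_x)) {1}xE; apply/eqP/esym.
case: i => [[|[|[|//]]]] lt_i; last 1 first.
- by rewrite (_ : Ordinal _ = i_y) //; apply: val_inj.
- by rewrite (_ : Ordinal _ = i_t) //; apply: val_inj.
- by rewrite (_ : Ordinal _ = i_x) //; apply: val_inj.
Qed.

Lemma grading_inj : injective grading.
Proof. by move=> z w E; apply/mpolyP => m; rewrite -!grading_coef E. Qed.

Lemma size_grading_coef z n : (size ((grading z)`_n)%R <= n.+1)%N.
Proof.
elim/mpolyind: z => [|c m z _ _ IH]; first by rewrite grading0 coef0 size_poly0.
rewrite gradingDn (leq_trans (size_polyD _ _)) // geq_max IH andbT.
rewrite grading_term coefCM coefXn; have [->|_] := eqVneq n _; last first.
  by rewrite mulr0 size_poly0.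
by rewrite mulr1 (leq_trans (size_scale_leq _ _)) // size_polyXn ltnS leq_addr.
Qed.

Definition tdegree_bound z := (\max_(n < size (grading z))
  \max_(j < size ((grading z)`_n)%R) size (((grading z)`_n)`_j)%R)%N.

Lemma tdegree_boundP z n j :
  (size (((grading z)`_n)`_j)%R <= tdegree_bound z)%N.
Proof.
have [sn|ns] := leqP (size (grading z)) n.
  by rewrite [(grading z)`_n]nth_default // coef0 size_poly0.
have [sj|js] := leqP (size ((grading z)`_n)%R) j.
  by rewrite [_`_j]nth_default // size_poly0.
rewrite /tdegree_bound (bigD1 (Ordinal ns)) //=.
rewrite (leq_trans _ (leq_maxl _ _)) //.
by rewrite (bigD1 (Ordinal js)) //= leq_maxl.
Qed.

Lemma grading_homog z d :
  z \is d.-homog for xy_degree -> grading z = ((grading z)`_d)%:P * 'X^d.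
Proof.
move=> /dhomogP zd; suff [P ->] : exists P, grading z = P%:P * 'X^d.
  by rewrite coefCM coefXn eqxx mulr1.
exists (\sum_(m <- msupp z) ((z@_m *: 'X^(m i_t)) *: 'X^(m i_x))).
rewrite {1}[z]mpolyE !rmorph_sum mulr_suml /=; apply: eq_big_seq => m /zd dE.
by rewrite -dE; exact: grading_term.
Qed.

Lemma mem_span_txy z : exists g a b, z = poly_in_t g + ('X_i_x * a + 'X_i_y * b).
Proof.
elim/mpolyind: z => [|c m z _ _ [g [a [b IH]]]].
  by exists 0, 0, 0; rewrite rmorph0 !mulr0 !addr0.
have [d dE] : exists g' a' b',
    c *: 'X_[m] = poly_in_t g' + ('X_i_x * a' + 'X_i_y * b') :> S; last first.
  case: dE => a' [b' ->]; exists (d + g), (a' + a), (b' + b).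
  by rewrite IH rmorphD /=; ring.
have mE : 'X_[m] = 'X_i_t ^+ m i_t * 'X_i_x ^+ m i_x * 'X_i_y ^+ m i_y :> S.
  rewrite mpolyXE_id !big_ord_recl big_ord0 mulr1 mulrA.
  by congr ('X_ _ ^+ m _ * 'X_ _ ^+ m _ * 'X_ _ ^+ m _); apply: val_inj.
rewrite mE; case: (m i_x) (m i_y) => [|b'] [|c'].
- exists (c *: 'X^(m i_t)), 0, 0; rewrite !mulr0 !addr0 !mulr1.
  by rewrite linearZ /= rmorphXn /= /poly_in_t horner_algX -scalerAl mul1r.
- exists 0, 0, (c *: ('X_i_t ^+ m i_t * 'X_i_y ^+ c')).
  by rewrite rmorph0 mulr0 !add0r -scalerAr exprS; congr (_ *: _); ring.
- exists 0, (c *: ('X_i_t ^+ m i_t * 'X_i_x ^+ b')), 0.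
  by rewrite rmorph0 mulr0 addr0 add0r -scalerAr exprS; congr (_ *: _); ring.
- exists 0, (c *: ('X_i_t ^+ m i_t * 'X_i_x ^+ b' * 'X_i_y ^+ c'.+1)), 0.
  by rewrite rmorph0 mulr0 addr0 add0r -scalerAr exprS; congr (_ *: _); ring.
Qed.

Section Relations.
Variables (gens : set S) (D q : nat).
Hypothesis gens_homog : forall w, gens w ->
  exists d, grading w = ((grading w)`_d)%:P * 'X^d.
Hypothesis gens_deg : forall w n j, gens w ->
  (size ((grading w)`_n`_j)%R <= D.+1)%N.
Hypotheses (gens_x : gens ('X_i_x ^+ q)) (gens_y : gens ('X_i_y ^+ q)).
Local Notation J := (ideal_gen gens).

(** All elements of low [t]-degree in the degree [n] part of the ideal, rather
    than a list of multiples of the generators: this set is closed under the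
    multiplications by [x] and [y] that relate the degrees. *)
Definition relations n : set {poly A} := [set P : {poly A} | [/\
  (size P <= n.+1)%N, forall j, (size (P`_j)%R <= D.+1)%N &
  exists2 z, J z & grading z = P%:P * 'X^n]].

(** Multiplying by [x^b y^c] multiplies the vector by [u^b] and leaves its
    coefficients, hence its [t]-degree, unchanged. *)
Lemma relations_shift n b c P :
  relations n P -> relations (b + c + n) ('X^b * P).
Proof.
case=> szP degP [z Jz zP]; split.
- have [->|P0] := eqVneq P 0; first by rewrite mulr0 size_poly0.
  rewrite size_monicM ?monicXn // size_polyXn addSn /=.
  by rewrite -addnA -addnS leq_add2l -addnS (leq_trans szP) ?leq_addl.
- by move=> j; rewrite coefXnM; case: ifP => _ //; rewrite size_poly0.
- exists ('X_i_x ^+ b * 'X_i_y ^+ c * z).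
    by have [_ _ JM] := is_ideal_gen gens; apply: JM.
  by rewrite grading_xy zP polyCM [in RHS]exprD mulrACA.
Qed.

(** Multiplying a generator by [x] or [y] does not raise its [t]-degree, and
    multiplying it by [t] stays within the [k[t]]-span: in every degree the
    ideal is spanned over [k[t]] by elements whose [t]-degree is at most that
    of its generators. *)
Lemma mem_relations z n : J z -> submodule_gen (relations n) (grading z)`_n.
Proof.
move=> Jz.
apply: (Jz [set z | forall n, submodule_gen (relations n) (grading z)`_n]).
split=> [|w gw {}n] /=; last first.
  have [d wd] := gens_homog gw; have [nd|nd] := eqVneq n d; last first.
    rewrite wd coefCM coefXn (negbTE nd) mulr0.
    by case: (is_submodule_gen (relations n)).
  apply: sub_gen_smallest; split; first exact: size_grading_coef.
    by move=> j; exact: gens_deg.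
  by exists w; [exact: sub_gen_smallest|rewrite nd].
split=> [{}n|u v /= Ju Jv {}n|a u /= Ju {}n] /=;
  have [N0 ND NZ] := is_submodule_gen (relations n).
- by rewrite grading0 coef0.
- by rewrite gradingDn; apply: ND.
elim/mpolyind: a => [|c m a _ _ IH]; first by rewrite mul0r grading0 coef0.
rewrite mulrDl gradingDn; apply: (ND) => //.
rewrite gradingM grading_term -mulrA coefCM coefXnM.
case: ltnP => [_|mn]; first by rewrite mulr0.
rewrite -scalerAl; apply: NZ.
have := @submodule_gen_map _ _ _ ('X^(m i_x) \o* idfun)
  (relations (n - xy_degree m)) (relations n).
rewrite /= mulrC; apply; last exact: Ju.
move=> P /(relations_shift (m i_x) (m i_y)) /=; rewrite subnKC // mulrC => WP.
exact: sub_gen_smallest.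
Qed.

(** Each graded piece of [z] comes from an element of the ideal, and their sum
    is [z] because [grading] is injective. *)
Lemma relations_mem z :
  (forall n, submodule_gen (relations n) (grading z)`_n) -> J z.
Proof.
have [J0 JD JM] := is_ideal_gen gens.
move=> zW; have zn n : exists2 w, J w & grading w = ((grading z)`_n)%:P * 'X^n.
  apply: (zW n [set P | exists2 w, J w & grading w = P%:P * 'X^n]).
  split=> [|P []//]; split=> [|P Q [w Jw wP] [w' Jw' wQ]|g P [w Jw wP]] /=.
  - by exists 0; rewrite ?grading0 ?mul0r.
  - by exists (w + w'); [apply: JD|rewrite gradingD !rmorphD /= wP wQ mulrDl].
  - exists (poly_in_t g * w); first exact: JM.
    by rewrite gradingM grading_poly_in_t wP -mul_polyC polyCM mulrA.
have [w Jw wE] : exists2 w, J w &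
    grading w = \sum_(n < size (grading z)) ((grading z)`_n)%:P * 'X^n.
  elim: (size _) => [|N [w Jw wE]]; first by exists 0; rewrite ?grading0 ?big_ord0.
  have [w' Jw' wE'] := zn N.
  by exists (w + w'); [apply: JD|rewrite big_ord_recr gradingD /= wE wE'].
suff -> : z = w by [].
apply: grading_inj; rewrite wE -[LHS]coefK poly_def.
by apply: eq_bigr => n _; rewrite mul_polyC.
Qed.

(** A monomial of degree at least [2 * q] is divisible by [x^q] or by [y^q]. *)
Lemma relations_full z n :
  (2 * q <= n)%N -> submodule_gen (relations n) (grading z)`_n.
Proof.
have [J0 JD JM] := is_ideal_gen gens.
move=> qn; have [N0 ND NZ] := is_submodule_gen (relations n).
elim/mpolyind: z => [|c m z _ _ IH]; first by rewrite grading0 coef0.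
rewrite gradingDn; apply: (ND) => //.
rewrite grading_term coefCM coefXn.
have [nE|_] := eqVneq n _; last by rewrite mulr0.
rewrite mulr1; apply: NZ; apply: sub_gen_smallest; split.
- by rewrite size_polyXn ltnS nE leq_addr.
- by move=> j; rewrite coefXn; case: eqP => _; rewrite ?size_poly1 ?size_poly0.
exists ('X_i_x ^+ m i_x * 'X_i_y ^+ m i_y); last first.
  by rewrite -[X in grading X]mulr1 grading_xy rmorph1 mulr1 nE.
have [qx|xq] := leqP q (m i_x).
  rewrite -(subnK qx) exprD mulrAC; apply: (JM); exact: sub_gen_smallest.
have qy : (q <= m i_y)%N.
  by rewrite -(leq_add2l q) addnn -mul2n (leq_trans qn) // nE leq_add2r ltnW.
rewrite -(subnK qy) exprD mulrA; apply: (JM); exact: sub_gen_smallest.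
Qed.

(** In degree [n < 2 * q] this is [bounded_torsion] for a module on
    [n.+1 <= 2 * q] generators; in the other degrees the quotient is zero. *)
Lemma relations_torsion n : exists Delta : A,
  [/\ Delta != 0, (size Delta <= (2 * q * D).+1)%N &
   forall g z, g != 0 -> submodule_gen (relations n) (g *: (grading z)`_n) ->
     submodule_gen (relations n) (Delta *: (grading z)`_n)].
Proof.
have [_ _ NZ] := is_submodule_gen (relations n).
have [qn|nq] := leqP (2 * q) n.
  exists 1; split; rewrite ?oner_neq0 ?size_poly1 // => g z _ _.
  by apply: NZ; exact: relations_full.
pose W := [set v : 'rV_n.+1 | relations n (rVpoly v)].
have [|Delta [D0 szD DW]] := @bounded_torsion _ n.+1 D W.
  by move=> v j [_ degv _]; have := degv j; rewrite coef_rVpoly_ord.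
exists Delta; split=> //.
  by rewrite (leq_trans szD) // ltnS leq_mul2r nq orbT.
move=> g z g0 gz; have zK := poly_rV_K (size_grading_coef z n).
have := submodule_gen_map (f := @rVpoly A n.+1) (W := W)
  (W' := relations n) _ (v := Delta *: poly_rV (grading z)`_n).
rewrite linearZ /= zK; apply; first by move=> w Ww; exact: sub_gen_smallest.
apply: (DW g) => //; rewrite -linearZ.
apply: (submodule_gen_map (f := @poly_rV A n.+1) _ gz) => P WP.
by apply: sub_gen_smallest; rewrite /W /= poly_rV_K //; case: WP.
Qed.

Lemma ideal_torsion : exists2 G : A, G != 0 &
  forall g z, g != 0 -> J (poly_in_t g * z) -> J (poly_in_t G * z).
Proof.
have /choice[Delta DP] := relations_torsion.
exists (\prod_(n < 2 * q) Delta n).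
  by apply/prodf_neq0 => n _; have [] := DP n.
move=> g z g0 gz; apply: relations_mem => n; rewrite coef_grading_poly_in_t.
have [_ _ NZ] := is_submodule_gen (relations n).
have [qn|nq] := leqP (2 * q) n; first by apply: NZ; exact: relations_full.
rewrite (bigD1 (Ordinal nq)) //= mulrC -scalerA; apply: NZ.
have [_ _ H] := DP n; apply: (H g) => //.
by rewrite -coef_grading_poly_in_t; exact: mem_relations.
Qed.

(** In each degree the element is killed by [P ^+ m] and by some [Delta] of
    degree at most [2 * q * D], hence by their greatest common divisor, a
    power of [P] of exponent at most [2 * q * D]. *)
Lemma ideal_irreducible_torsion (P : A) m z : irreducible_poly P ->
  J (poly_in_t (P ^+ m) * z) -> J (poly_in_t (P ^+ ((2 * D).+1 * q)) * z).
Proof.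
move=> irrP Pz; apply: relations_mem => n; rewrite coef_grading_poly_in_t.
have [_ ND NZ] := is_submodule_gen (relations n).
have {}Pz : submodule_gen (relations n) (P ^+ m *: (grading z)`_n).
  by rewrite -coef_grading_poly_in_t; exact: mem_relations.
have [Delta [D0 szD DW]] := relations_torsion n.
have Pm0 : P ^+ m != 0 by rewrite expf_neq0 // irredp_neq0.
have {DW} Dz := DW _ _ Pm0 Pz.
have [a [g [DE ng aD]]] := irreducible_multiplicity irrP D0.
have aq : (a <= (2 * D).+1 * q)%N.
  rewrite -ltnS (leq_trans aD) // (leq_trans szD) // ltnS mulnAC leq_mul2r.
  by rewrite leqnSn orbT.
rewrite -(subnK aq) exprD -scalerA; apply: (NZ).
have : coprimep (P ^+ m) g by apply: coprimep_expl; rewrite irreducible_poly_coprime.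
move=> /coprimep_bezout[u [v uv]].
have -> : P ^+ a *: (grading z)`_n =
    (P ^+ a * u) *: (P ^+ m *: (grading z)`_n) + v *: (Delta *: (grading z)`_n).
  rewrite !scalerA -scalerDl; congr (_ *: _).
  by rewrite DE -[LHS]mulr1 -uv; move: (P ^+ a) (P ^+ m) => *; ring.
by apply: ND; apply: NZ.
Qed.

End Relations.
End Grading.

(** * Descent to the quotient ring *)

Lemma quotient_frobenius_power (R : comPzRingType) (A B : set R) p e :
  prime p -> p%:R = 0 :> R -> forall z : R,
  frobenius_power (ideal_gen [set quotient_map A b | b in B]) (p ^ e)
    (quotient_map A z)
  <-> ideal_gen (A `|` [set b ^+ (p ^ e) | b in B]) z.
Proof.
move=> p_pr pR z.
have pQ : p%:R = 0 :> quotient_ring A.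
  by rewrite -(rmorph_nat (quotient_map A)) pR rmorph0.
rewrite frobenius_power_gen //; set J := ideal_gen (_ `|` _).
have [J0 JD JM] : is_ideal J by exact: is_ideal_gen.
set I := ideal_gen [set w ^+ (p ^ e) | w in [set quotient_map A b | b in B]].
have [I0 ID IM] : is_ideal I by exact: is_ideal_gen.
split=> [Iz|Jz]; last first.
  apply: (Jz [set z | I (quotient_map A z)]); split=> [|w [Aw|[b Bb <-]]] /=.
  - split=> [|u v Iu Iv|a u Iu] /=; first by rewrite rmorph0.
      by rewrite rmorphD; apply: ID.
    by rewrite rmorphM; apply: IM.
  - suff -> : quotient_map A w = quotient_map A 0 by rewrite rmorph0.
    by apply/quotient_map_eq; rewrite subr0; exact: sub_gen_smallest.
  - rewrite rmorphXn; apply: sub_gen_smallest.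
    by exists (quotient_map A b) => //; exists b.
have [z' Jz' /quotient_map_eq zz'] : exists2 z', J z' &
    quotient_map A z = quotient_map A z'.
  apply: (Iz [set w | exists2 z', J z' & w = quotient_map A z']); split; last first.
    move=> _ [_ [b Bb <-] <-]; exists (b ^+ (p ^ e)); last by rewrite rmorphXn.
    by apply: sub_gen_smallest; right; exists b.
  split=> [|_ _ [u Ju ->] [v Jv ->]|a _ [u Ju ->]] /=.
  - by exists 0; rewrite ?rmorph0.
  - by exists (u + v); [apply: JD|rewrite rmorphD].
  - have [b <-] := quotient_map_surj a.
    by exists (b * u); [apply: JM|rewrite rmorphM].
rewrite -(subrK z' z); apply: (JD) => //.
apply: (zz' J); split; first exact: is_ideal_gen.
by move=> w Aw; apply: sub_gen_smallest; left.
Qed.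

Theorem corollary3p5 (k : fieldType) (p : nat) (hp : p \in [pchar k])
    (r : nat) (f : 'I_r -> {mpoly k[3]})
    (hf : forall i, exists d : nat, f i \is d.-homog for xy_degree) :
  let pi := quotient_map (range f) in
  linear_growth_primary_decompositions p (ideal_gen [set pi 'X_i_x; pi 'X_i_y]).
Proof.
move=> pi; have [p_pr /eqP pk] := andP hp.
have pS : p%:R = 0 :> {mpoly k[3]} by rewrite -mpolyC_nat pk mpolyC0.
have pR : p%:R = 0 :> quotient_ring (range f).
  by rewrite -(rmorph_nat pi) pS rmorph0.
have -> : [set pi 'X_i_x; pi 'X_i_y] = [set pi b | b in [set 'X_i_x; 'X_i_y]].
  by rewrite image_setU !image_set1.
pose D := (\max_(i < r) tdegree_bound (f i))%N.
(* [D] bounds the [t]-degrees of the [f i]; it is fixed before [q]. *)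
exists (2 * D).+1 => // e; set q := (p ^ e)%N.
have q_gt0 : (0 < q)%N by rewrite expn_gt0 prime_gt0.
pose gens := range f `|` [set b ^+ q | b in [set 'X_i_x; 'X_i_y]].
have gx : gens ('X_i_x ^+ q) by right; exists 'X_i_x => //; left.
have gy : gens ('X_i_y ^+ q) by right; exists 'X_i_y => //; right.
have thx : grading ('X_i_x ^+ q : {mpoly k[3]}) = ('X^q)%:P * 'X^q.
  have := grading_xy (1 : {mpoly k[3]}) q 0.
  by rewrite expr0 !mulr1 [grading 1]rmorph1 mulr1 addn0.
have thy : grading ('X_i_y ^+ q : {mpoly k[3]}) = (1 : {poly {poly k}})%:P * 'X^q.
  have := grading_xy (1 : {mpoly k[3]}) 0 q.
  by rewrite !expr0 mul1r mulr1 [grading 1]rmorph1 mulr1 add0n.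
have ghom w : gens w -> exists d, grading w = ((grading w)`_d)%:P * 'X^d.
  case=> [[i _ <-]|[_ [->|->] <-]].
  - by have [d fd] := hf i; exists d; exact: grading_homog.
  - by exists q; rewrite thx coefCM coefXn eqxx mulr1.
  - by exists q; rewrite thy coefCM coefXn eqxx mulr1.
have gdeg w n j : gens w -> (size (((grading w)`_n)`_j)%R <= D.+1)%N.
  case=> [[i _ <-]|[_ [->|->] <-]].
  - rewrite (leq_trans (tdegree_boundP _ _ _)) // leqW // /D.
    exact: (leq_bigmax i).
  - rewrite thx coefCM coefXn; case: eqP => _;
      rewrite ?mulr0 ?coef0 ?size_poly0 // mulr1.
    by rewrite coefXn; case: eqP => _; rewrite ?size_poly1 ?size_poly0.
  - rewrite thy coefCM coefXn; case: eqP => _;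
      rewrite ?mulr0 ?coef0 ?size_poly0 // mulr1.
    by rewrite coef1; case: eqP => _; rewrite ?size_poly1 ?size_poly0.
pose J := frobenius_power (ideal_gen [set pi b | b in [set 'X_i_x; 'X_i_y]]) q.
have JP z : J (pi z) <-> ideal_gen gens z by exact: quotient_frobenius_power.
pose iota : {rmorphism {poly k} -> quotient_ring (range f)} :=
  pi \o @poly_in_t k.
have iotaM g w : iota g * pi w = pi (poly_in_t g * w) by rewrite [RHS]rmorphM.
have [G G0 GJ] := ideal_torsion ghom gdeg gx gy.
apply: (@primary_decomposition_growth k _ iota (pi 'X_i_x) (pi 'X_i_y) J q
  _ _ _ _ _ _ _ G G0 _ _ p e) => //.
- move=> z; have [w <-] := quotient_map_surj z.
  have [g [a [b ->]]] := mem_span_txy w; exists g, (pi a), (pi b).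
  by rewrite /pi rmorphD [in LHS]rmorphD !rmorphM.
- exact: is_ideal_gen.
- by rewrite /pi -rmorphXn; apply/JP; exact: sub_gen_smallest.
- by rewrite /pi -rmorphXn; apply/JP; exact: sub_gen_smallest.
- move=> g z; have [w <-] := quotient_map_surj z; rewrite !iotaM.
  by move=> g0 /JP gw; apply/JP; exact: GJ gw.
- move=> P m z irrP; have [w <-] := quotient_map_surj z; rewrite !iotaM.
  move=> /JP Pw; apply/JP.
  exact: (ideal_irreducible_torsion ghom gdeg gx gy irrP Pw).
Qed.
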